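(* Let $F$ be a number field of degree $n=[F:\mathbb{Q}]$ with $s=n-2>0$ real embeddings $\sigma_1,\dots,\sigma_s$ and exactly two non-real embeddings $\sigma_{s+1},\overline{\sigma_{s+1}}$. Let $M=M(F,\mathcal{O}_F^{*,+})$ be the Oeljeklaus–Toma manifold with the locally conformal K\''ahler structure given by the K\''ahler potential $\phi$ below, so that $\dim_\mathbb{C}M=n-1$, $b_1(M)=n-2$, and the rank $r(M)$ of $M$ equals the rank of the multiplicative group $\{|\sigma_{s+1}(u)|^2: u\in\mathcal{O}_F^{*,+}\}\subset\mathbb{R}_{>0}$. Then: (1) If $n$ is odd, the map $u\mapsto|\sigma_{s+1}(u)|^2$ is injective on $\mathcal{O}_F^{*,+}$, and $r(M)=b_1(M)=n-2$. (2) If $n$ is even, then either $r(M)=b_1(M)=n-2$ or $r(M)=b_1(M)/2=(n-2)/2$; the latter occurs if and only if $F$ is a quadratic extension of a totally real number field.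
   Context: Notation: $\sigma_1,\dots,\sigma_n$ are the complex embeddings of $F$; $\mathcal{O}_F$ the ring of integers; $\mathcal{O}_F^{*,+}$ the units of $\mathcal{O}_F$ that are positive under every real embedding. With $t=1$, $\mathcal{O}_F^{*,+}$ is admissible and $M(F,\mathcal{O}_F^{*,+})=(\mathbb{H}^s\times\mathbb{C})/(\mathcal{O}_F\rtimes\mathcal{O}_F^{*,+})$, where $a\in\mathcal{O}_F$ acts by $T_a(z)=(z_1+\sigma_1(a),\dots,z_{s+1}+\sigma_{s+1}(a))$ and $u\in\mathcal{O}_F^{*,+}$ by $R_u(z)=(\sigma_1(u)z_1,\dots,\sigma_{s+1}(u)z_{s+1})$. The K\''ahler metric on $\mathbb{H}^s\times\mathbb{C}$ is $i\partial\bar\partial\phi$ with $\phi(z)=\prod_{j=1}^s\frac{i}{z_j-\bar z_j}+|z_{s+1}|^2$; the $T_a$ are isometries and $R_u^*\phi=|\sigma_{s+1}(u)|^2\phi$, so $(\mathbb{H}^s\times\mathbb{C},\mathcal{O}_F\rtimes\mathcal{O}_F^{*,+})$ is an \textsc{lck}-presentation of $M$. The rank $r(M)$ of an lcK manifold presented as $(K,\Gamma)$ is the rank of the subgroup of $\mathbb{R}_{>0}$ formed by the dilation factors of the elements of $\Gamma$. *)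

(* Defs.v *)
From HB Require Import structures.
From mathcomp Require Import all_boot all_order all_algebra all_field.
Set Implicit Arguments. Unset Strict Implicit. Unset Printing Implicit Defensive.
Import Order.TTheory GRing.Theory Num.Theory.
Local Open Scope ring_scope.

(* A number field is modelled as F : fieldExtType rat (finite dimensional
   extension of Q); its degree is \dim {:F}; complex embeddings are ring
   morphisms F -> algC. *)

Definition real_emb (F : fieldExtType rat) (s : {rmorphism F -> algC}) : Prop :=
  forall x : F, s x \is Num.real.

Definition totally_real (F : fieldExtType rat) : Prop :=
  forall s : {rmorphism F -> algC}, real_emb s.

(* Ring of integers O_F: elements integral over Z (algebraic integers);
   integrality does not depend on the embedding, we test all of them. *)
Definition in_OF (F : fieldExtType rat) (x : F) : Prop :=
  forall s : {rmorphism F -> algC}, s x \in Aint.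

Definition totpos_unit (F : fieldExtType rat) (u : F) : Prop :=
  [/\ u != 0, in_OF u, in_OF u^-1 &
      forall s : {rmorphism F -> algC}, real_emb s -> 0 < s u].

Definition mult_indep (xs : seq algC) : Prop :=
  forall es : seq int, size es = size xs ->
    \prod_(i < size xs) (xs`_i ^ es`_i) = 1 -> forall i, es`_i = 0.

Definition has_rank (S : algC -> Prop) (r : nat) : Prop :=
  (exists xs : seq algC, size xs = r /\ (forall i, (i < size xs)%N -> S xs`_i)
                          /\ mult_indep xs)
  /\ (forall xs : seq algC, (forall i, (i < size xs)%N -> S xs`_i) ->
        mult_indep xs -> (size xs <= r)%N).

Definition dilations (F : fieldExtType rat) (s : {rmorphism F -> algC})
  (c : algC) : Prop :=
  exists u : F, totpos_unit u /\ c = `|s u| ^+ 2.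

Definition rank_OT (F : fieldExtType rat) (s : {rmorphism F -> algC})
  (r : nat) : Prop := has_rank (dilations s) r.

Definition quad_ext_of_totally_real (F : fieldExtType rat) : Prop :=
  exists K : {subfield F}, (\dim {:F} = 2 * \dim K)%N /\
    totally_real (subvs_of K).

(* Main.v *)
(* The kernel of u |-> |sigma u|^2 on totally positive units decides
   everything.  If u <> 1 lies in it, then sigma u is not real and sigma is the
   only extension to F of its restriction to Q(u), so F = Q(u); moreover
   w = u + 1/u satisfies sigma w = 2 Re (sigma u), so F is quadratic over the
   totally real field Q(w), and n is even.  If the kernel is trivial, the
   dilation group has the rank n - 2 of the unit group.  If F is quadratic over
   a field K, its involution iota induces complex conjugation at sigma, hence
   |sigma u|^2 = sigma (u * iota u): dilations are norms to K, and their rank is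
   the number of pairs of real embeddings exchanged by iota.

   The two facts of Dirichlet's unit theorem needed here are proved without
   logarithms.  Upper bound: among monomials with exponents below N in too many
   units, the pigeonhole principle finds two that lie in the same dyadic boxes
   at the relevant places and are congruent modulo a large integer, hence are
   equal.  Lower bound: for every real place i there is a unit that is small at
   all other places, and such units are independent because the common value of
   the two sides of a relation would be small everywhere, contradicting the
   product formula. *)

Require Import Defs.
From HB Require Import structures.
From mathcomp Require Import all_boot all_order all_algebra all_field.
From mathcomp Require Import perm zify ring.
From Stdlib Require Import Classical.
Import Order.TTheory GRing.Theory Num.Theory.
Local Open Scope ring_scope.
Set Implicit Arguments.
Unset Strict Implicit.
Unset Printing Implicit Defensive.

(** * Extending embeddings *)

(** Every element of F is a polynomial in [x] over K. Evaluating that polynomial at [r] instead is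
    well defined: two choices differ by a multiple of the minimal polynomial, whose image vanishes
    at [r]. *)
Lemma extend_root (F : fieldExtType rat) (K : {subfield F}) (L : fieldType)
    (rho : {rmorphism subvs_of K -> L}) (x : F) (q : {poly subvs_of K})
    (r : L) :
  <<K; x>>%VS = fullv -> minPoly K x = map_poly vsval q ->
  root (map_poly rho q) r ->
  exists tau : {rmorphism F -> L},
    (forall y, tau (vsval y) = rho y) /\ tau x = r.
Proof.
move=> genF defq qr.
pose c (y : F) : {poly subvs_of K} := map_poly (vsproj K) (Fadjoin_poly K x y).
pose g (p : {poly subvs_of K}) : F := (map_poly vsval p).[x].
pose h (p : {poly subvs_of K}) : L := (map_poly rho p).[r].
have gc y : g (c y) = y.
  rewrite /g /c -map_poly_comp map_poly_id ?Fadjoin_poly_eq ?genF ?memvf //.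
  move=> z /(nthP 0)[i _ <-] /=; rewrite vsprojK //.
  exact: (polyOverP (Fadjoin_polyOver K x y)).
have gh p1 p2 : g p1 = g p2 -> h p1 = h p2.
  move=> /eqP; rewrite -subr_eq0 -hornerN -hornerD -!rmorphN -rmorphD => g0.
  have: q %| p1 - p2.
    rewrite -(dvdp_map vsval) -defq minPoly_dvdp //.
    by apply/polyOver_subvs; exists (p1 - p2).
  move=> /dvdpP[p3 def3]; apply/eqP; rewrite -subr_eq0.
  rewrite -hornerN -hornerD -!rmorphN -rmorphD def3 rmorphM hornerM.
  by rewrite (rootP qr) mulr0.
pose tau y := h (c y).
have tauB : zmod_morphism tau.
  move=> y z; rewrite /tau (@gh _ (c y - c z)) ?gc.
    by rewrite /h rmorphB hornerD hornerN.
  by rewrite /g rmorphB hornerD hornerN -!/(g _) !gc.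
have tauM : monoid_morphism tau.
  split=> [|y z]; rewrite /tau.
    by rewrite (@gh _ 1) ?gc /g /h ?rmorph1 ?hornerC.
  rewrite (@gh _ (c y * c z)) ?gc; first by rewrite /h rmorphM hornerM.
  by rewrite /g rmorphM hornerM -!/(g _) !gc.
pose T : {rmorphism F -> L} := HB.pack tau
  (GRing.isZmodMorphism.Build _ _ tau tauB)
  (GRing.isMonoidMorphism.Build _ _ tau tauM).
exists T; split=> [y|]; rewrite /T /= /tau.
  by rewrite (@gh _ y%:P) ?gc /g /h map_polyC hornerC.
by rewrite (@gh _ 'X) ?gc /g /h map_polyX hornerX.
Qed.

Lemma primitive_element (F : fieldExtType rat) (K : {subfield F}) :
  exists x, <<K; x>>%VS = fullv.
Proof.
have sepF : separable K {:F}.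
  apply/separableP=> y _; apply: pcharf0_separable => p.
  by rewrite pchar_lalg pchar_num.
exists (separable_generator K {:F}).
by rewrite -eq_adjoin_separable_generator ?subvf.
Qed.

(** Extensions of [rho] correspond to the roots of the image of the minimal polynomial of a
    primitive element [x]. In characteristic zero these roots are distinct, so there are [F:K] of
    them and [x] separates the extensions. *)
Lemma extensions (F : fieldExtType rat) (K : {subfield F})
    (rho : {rmorphism subvs_of K -> algC}) :
  exists (x : F) (e : 'I_(\dim {:F} %/ \dim K) -> {rmorphism F -> algC}),
   [/\ forall i y, e i (vsval y) = rho y,
       injective (fun i => e i x) &
       forall tau : {rmorphism F -> algC}, (forall y, tau (vsval y) = rho y) ->
         exists i, tau =1 e i].
Proof.
have [x genF] := primitive_element K; exists x.
have dimF : (\dim {:F} %/ \dim K = adjoin_degree K x)%N.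
  by rewrite -genF dim_Fadjoin mulnK // adim_gt0.
have /polyOver_subvs[q defq] := minPolyOver K x.
have sz_q : size q = (adjoin_degree K x).+1.
  by rewrite -(size_map_poly vsval) -defq size_minPoly.
have mon_q : q \is monic by rewrite -(map_monic vsval) -defq monic_minPoly.
have [rs Drs] := closed_field_poly_normal (map_poly rho q).
move: Drs; rewrite (monicP _) ?map_monic // scale1r => Drs.
have sz_rs : size rs = (\dim {:F} %/ \dim K)%N.
  apply: succn_inj; rewrite dimF -sz_q -(size_prod_XsubC rs id) -Drs.
  exact: size_map_poly.
have uniq_rs : uniq rs.
  rewrite -separable_prod_XsubC -Drs separable_map -(separable_map vsval) -defq.
  by apply: pcharf0_separable => p; rewrite pchar_lalg pchar_num.
have /fin_all_exists[e De] : forall i : 'I_(\dim {:F} %/ \dim K),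
    exists tau : {rmorphism F -> algC},
      (forall y, tau (vsval y) = rho y) /\ tau x = rs`_i.
  move=> i; apply: (extend_root genF defq).
  by rewrite Drs root_prod_XsubC mem_nth // sz_rs.
exists e; split=> [i y|i j|tau Dtau]; first by case: (De i).
- have [[_ ->] [_ ->]] := (De i, De j) => /eqP.
  by rewrite nth_uniq ?sz_rs // => /eqP/val_inj.
have taux p : tau (map_poly vsval p).[x] = (map_poly rho p).[tau x].
  by rewrite -horner_map -map_poly_comp (eq_map_poly Dtau).
have : tau x \in rs.
  by rewrite -root_prod_XsubC -Drs /root -taux -defq minPolyxx rmorph0.
case/(nthP 0)=> i; rewrite sz_rs => lti Di; exists (Ordinal lti) => y.
have [ext val_x] := De (Ordinal lti).
have : y \in <<K; x>>%VS by rewrite genF memvf.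
case/Fadjoin_polyP=> _ /polyOver_subvs[p ->] ->.
rewrite taux -horner_map -map_poly_comp -Di.
by rewrite (eq_map_poly ext) -/(e _) val_x.
Qed.

(** * Algebraic integers, norm and discriminant *)

Lemma in_OF1 (F : fieldExtType rat) : in_OF (1 : F).
Proof. by move=> s; rewrite rmorph1 rpred1. Qed.

Lemma in_OFD (F : fieldExtType rat) (x y : F) :
  in_OF x -> in_OF y -> in_OF (x + y).
Proof. by move=> Ox Oy s; rewrite rmorphD rpredD. Qed.

Lemma in_OFM (F : fieldExtType rat) (x y : F) :
  in_OF x -> in_OF y -> in_OF (x * y).
Proof. by move=> Ox Oy s; rewrite rmorphM rpredM. Qed.

Lemma in_OF_int (F : fieldExtType rat) (z : int) : in_OF (z%:~R : F).
Proof. by move=> s; rewrite rmorph_int Aint_int. Qed.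

Lemma in_OF_sum (F : fieldExtType rat) (I : finType) (x : I -> F) :
  (forall i, in_OF (x i)) -> in_OF (\sum_i x i).
Proof. by move=> Ox s; rewrite rmorph_sum rpred_sum // => i _; apply: Ox. Qed.

Lemma in_OF_prod (F : fieldExtType rat) (I : finType) (x : I -> F) :
  (forall i, in_OF (x i)) -> in_OF (\prod_i x i).
Proof. by move=> Ox s; rewrite rmorph_prod rpred_prod // => i _; apply: Ox. Qed.

Lemma in_OFX (F : fieldExtType rat) (x : F) k : in_OF x -> in_OF (x ^+ k).
Proof. by move=> Ox s; rewrite rmorphXn rpredX. Qed.

Lemma common_denom (I : finType) (q : I -> rat) :
  exists2 d : nat, (0 < d)%N & forall i, d%:R * q i \is a Num.int.
Proof.
exists (\prod_i `|denq (q i)|)%N.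
  by rewrite prodn_gt0 // => i; rewrite absz_gt0 denq_neq0.
move=> i; rewrite (bigD1 i) //= natrM mulrAC rpredM ?rpred_nat //.
rewrite natr_absz ger0_norm ?denq_ge0 // mulrC.
by rewrite -numqE intr_int.
Qed.

(** Multiplication by [x] has a rational matrix in a Q-basis. If [d] clears its denominators,
    [s (d x)] is an eigenvalue of an integer matrix, the conjugates of the basis forming an
    eigenvector. *)
Lemma scaled_in_OF (F : fieldExtType rat) (x : F) :
  exists2 d : nat, (0 < d)%N & in_OF (d%:R * x).
Proof.
pose b := vbasis {:F}; pose n := \dim {:F}.
have bP y : y = \sum_i coord b i y *: b`_i by apply/coord_vbasis/memvf.
have [d d_gt0 dP] :=
  common_denom (fun ij : 'I_n * 'I_n => coord b ij.1 (x * b`_ij.2)).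
exists d => // s.
pose A : 'M[algC]_n := \matrix_(i, j) ratr (d%:R * coord b i (x * b`_j)).
pose v : 'rV[algC]_n := \row_i s b`_i.
have vA : v *m A = s (d%:R * x) *: v.
  apply/rowP=> j; rewrite !mxE -rmorphM -mulrA [x * _]bP mulr_sumr rmorph_sum.
  apply: eq_bigr => i _; rewrite !mxE !rmorphM !rmorph_nat.
  by rewrite rmorphZ_num /=; ring.
have v_neq0 : v != 0.
  apply/eqP=> v0; have := oner_neq0 algC; rewrite -(rmorph1 s) [1]bP.
  rewrite rmorph_sum big1 ?eqxx // => i _; rewrite rmorphZ_num.
  by move/rowP/(_ i): v0; rewrite !mxE => ->; rewrite mulr0.
have rootA : root (char_poly A) (s (d%:R * x)).
  by rewrite -eigenvalue_root_char; apply/eigenvalueP; exists v.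
apply: root_monic_Aint rootA (char_poly_monic A) _.
suff: char_poly A \is a polyOver Num.int_num_subdef by [].
rewrite rpred_sum // => t _; rewrite rpredMsign rpred_prod // => j _.
rewrite !mxE rpredB ?rpredMn ?polyOverX //.
rewrite polyOverC.
by have [z ->] := intrP (dP (j, t j)); rewrite ratr_int; apply: intr_int.
Qed.

Section Embeddings.

Variables (F : fieldExtType rat).
Let n := \dim {:F}.
Variable e : 'I_n -> {rmorphism F -> algC}.
Hypothesis e_onto : forall tau : {rmorphism F -> algC}, exists i, tau =1 e i.
Variable theta : F.
Hypothesis e_inj : injective (fun i => e i theta).

Lemma in_OF_emb x : (forall i, e i x \in Aint) -> in_OF x.
Proof. by move=> Ox s; have [i ->] := e_onto s. Qed.

Lemma integral_basis : exists B : 'I_n -> F,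
  [/\ forall j, in_OF (B j),
      forall x, exists q : 'I_n -> rat, x = \sum_j q j *: B j &
      forall q : 'I_n -> rat, \sum_j q j *: B j = 0 -> forall j, q j = 0].
Proof.
pose b := vbasis {:F}.
have [d d_gt0 Od] := fin_all_exists2 (fun j : 'I_n => scaled_in_OF b`_j).
have d_neq0 j : (d j)%:R != 0 :> rat by rewrite pnatr_eq0 -lt0n.
have dE j : (d j)%:R * b`_j = (d j)%:R *: b`_j.
  by rewrite scaler_nat mulr_natl.
exists (fun j => (d j)%:R * b`_j); split=> // [x|q].
  exists (fun j => coord b j x / (d j)%:R).
  rewrite {1}(coord_vbasis (memvf x)); apply: eq_bigr => j _.
  by rewrite dE scalerA divfK.
under eq_bigr do rewrite dE scalerA.
move=> q0 j; have /(congr1 (coord b j)) := q0.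
rewrite coord_sum_free ?(basis_free (vbasisP _)) // linear0 => /eqP.
by rewrite mulf_eq0 (negPf (d_neq0 j)) orbF => /eqP.
Qed.

Variable B : 'I_n -> F.
Hypothesis B_int : forall j, in_OF (B j).
Hypothesis B_span : forall x, exists q : 'I_n -> rat, x = \sum_j q j *: B j.

Let V : 'M[algC]_n := \matrix_(i, j) e i (B j).

(** Expanding the powers of [theta] in [B] makes [V^T] a factor of a Vandermonde matrix with
    distinct nodes. *)
Lemma emb_matrix_unit : V \in unitmx.
Proof.
have [C DC] := fin_all_exists (fun k : 'I_n => B_span (theta ^+ k)).
have VC : Vandermonde n (\row_i e i theta) =
    map_mx ratr (\matrix_(k, j) C k j) *m V^T.
  apply/matrixP=> k i; rewrite !mxE -rmorphXn DC rmorph_sum.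
  by apply: eq_bigr => j _; rewrite !mxE rmorphZ_num.
have : \det (Vandermonde n (\row_i e i theta)) != 0.
  rewrite det_Vandermonde; apply/prodf_neq0 => i _; apply/prodf_neq0 => j ltij.
  rewrite !mxE subr_eq0; apply: contraTneq ltij => /e_inj ->.
  by rewrite ltnn.
by rewrite VC det_mulmx mulf_eq0 negb_or det_tr unitmxE unitfE => /andP[].
Qed.

(* V conjugates the diagonal matrix of the e i x to the rational matrix of
   multiplication by x, so the norm and the trace are rational. *)
Lemma emb_matrix_conj x : exists A : 'M[rat]_n,
  diag_mx (\row_i e i x) = V *m map_mx ratr A *m invmx V.
Proof.
have [A DA] := fin_all_exists (fun j : 'I_n => B_span (x * B j)).
exists (\matrix_(k, j) A j k).
apply: (canRL (mulmxK emb_matrix_unit)).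
apply/matrixP=> i j; rewrite mul_diag_mx !mxE -rmorphM DA rmorph_sum.
by apply: eq_bigr => k _; rewrite !mxE rmorphZ_num mulrC.
Qed.

Lemma trace_rat x : \sum_i e i x \in Crat.
Proof.
have [A DA] := emb_matrix_conj x.
have := mxtrace_diag (\row_i e i x); under [RHS]eq_bigr do rewrite mxE.
move=> <-; rewrite DA mxtrace_mulC mulmxA mulVmx ?emb_matrix_unit // mul1mx.
by rewrite trace_map_mx; apply/CratP; exists (\tr A).
Qed.

Definition emb_norm x := \prod_i e i x.

Lemma emb_norm_rat x : emb_norm x \in Crat.
Proof.
have [A DA] := emb_matrix_conj x.
have := det_diag (\row_i e i x); under [RHS]eq_bigr do rewrite mxE.
rewrite -/(emb_norm x) => <-; rewrite DA !det_mulmx det_inv mulrAC divff.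
  by rewrite mul1r det_map_mx; apply/CratP; exists (\det A).
by have := emb_matrix_unit; rewrite unitmxE unitfE.
Qed.

Lemma emb_norm_int x : in_OF x -> emb_norm x \is a Num.int.
Proof.
move=> Ox; apply: Cint_rat_Aint; first exact: emb_norm_rat.
by rewrite rpred_prod // => i _; apply: Ox.
Qed.

Lemma emb_norm_eq0 x : (emb_norm x == 0) = (x == 0).
Proof.
apply/prodf_eq0/eqP => [[i _]|->]; first by rewrite fmorph_eq0 => /eqP.
have d_gt0 : (0 < n)%N by rewrite adim_gt0.
by exists (Ordinal d_gt0); rewrite ?rmorph0.
Qed.

Lemma emb_norm_ge1 x : in_OF x -> x != 0 -> 1 <= `|emb_norm x|.
Proof.
move=> Ox x0; apply: norm_intr_ge1; first exact: emb_norm_int.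
by rewrite emb_norm_eq0.
Qed.

Lemma emb_normM x y : emb_norm (x * y) = emb_norm x * emb_norm y.
Proof. by rewrite -big_split; apply: eq_bigr => i _; rewrite rmorphM. Qed.

Lemma norm_emb_norm_unit x :
  x != 0 -> in_OF x -> in_OF x^-1 -> `|emb_norm x| = 1.
Proof.
move=> x0 Ox Oxi; apply/eqP; rewrite eq_le emb_norm_ge1 // andbT.
have Nxi : `|emb_norm x| * `|emb_norm x^-1| = 1.
  rewrite -normrM -emb_normM divff // /emb_norm big1 ?normr1 // => i _.
  exact: rmorph1.
rewrite -[leRHS]Nxi ler_peMr ?normr_ge0 // emb_norm_ge1 // invr_eq0 //.
Qed.

(** The norm is an integer of absolute value at most [C], so it divides [C!]; and [x] divides its
    norm, the cofactor being a product of conjugates. *)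
Lemma in_OF_fact_div (C : nat) x :
  in_OF x -> x != 0 -> `|emb_norm x| <= C%:R -> in_OF (C`!%:R / x).
Proof.
move=> Ox x0 leC; have [z Dz] := intrP (emb_norm_int Ox).
have z0 : z != 0 by rewrite -(intr_eq0 algC) -Dz emb_norm_eq0.
have z_dvd : (`|z| %| C`!)%N.
  rewrite dvdn_fact // absz_gt0 z0 /=.
  by move: leC; rewrite Dz -intr_norm -abszE -pmulrn ler_nat.
have [m Dm] : exists m : int, C`!%:R = m%:~R * emb_norm x.
  case/dvdnP: z_dvd => k ->; exists (k%:Z * sgz z); rewrite Dz -rmorphM /=.
  by rewrite -mulrA -abszEsg -PoszM.
apply: in_OF_emb => i; rewrite rmorphM fmorphV rmorph_nat Dm.
rewrite /emb_norm (bigD1 i) //= mulrCA [e i x * _]mulrC mulfK ?fmorph_eq0 //.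
rewrite mulrC rpredM ?Aint_int // rpred_prod // => j _; exact: Ox.
Qed.

(** [D] is the absolute value of the discriminant [\det V ^+ 2], which is rational as the
    determinant of the trace form. By Cramer's rule the discriminant times a coordinate of [x] is an
    algebraic integer, and it is rational. *)
Lemma disc_scaling : exists2 D : nat, (0 < D)%N &
  forall x, in_OF x ->
    exists c : 'I_n -> int, D%:R * x = \sum_j (c j)%:~R * B j.
Proof.
have V0 : \det V != 0 by have := emb_matrix_unit; rewrite unitmxE unitfE.
have VV_rat : \det V ^+ 2 \in Crat.
  rewrite expr2 -{1}det_tr -det_mulmx.
  rewrite rpred_sum // => s _; rewrite rpredMsign rpred_prod // => j _.
  rewrite !mxE; under eq_bigr do rewrite !mxE -rmorphM.
  exact: trace_rat.
have detV_Aint : \det V \in Aint.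
  rewrite rpred_sum // => s _; rewrite rpredMsign rpred_prod // => j _.
  by rewrite mxE; apply: B_int.
have adjV_Aint i j : \adj V i j \in Aint.
  rewrite mxE /cofactor rpredMsign rpred_sum // => s _.
  by rewrite rpredMsign rpred_prod // => k _; rewrite !mxE; apply: B_int.
have /intrP[z Dz] : \det V ^+ 2 \is a Num.int.
  exact: (Cint_rat_Aint VV_rat (rpredX 2 detV_Aint)).
have z0 : z != 0 by rewrite -(intr_eq0 algC) -Dz expf_neq0.
exists `|z|%N; first by rewrite absz_gt0.
move=> x Ox; have [q Dq] := B_span x.
have Vq : V *m (\col_j ratr (q j)) = \col_i e i x.
  apply/colP=> i; rewrite !mxE {1}Dq rmorph_sum.
  by apply: eq_bigr => j _; rewrite !mxE rmorphZ_num mulrC.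
have int_q j : z%:~R * q j \is a Num.int.
  rewrite -Cint_rat rmorphM rmorph_int -Dz Cint_rat_Aint //.
    by rewrite rpredM ?VV_rat //; apply/CratP; exists (q j).
  have -> : \det V ^+ 2 * ratr (q j) =
      \det V * (\adj V *m (\col_i e i x)) j 0.
    by rewrite -Vq mulmxA mul_adj_mx mul_scalar_mx !mxE mulrA.
  rewrite rpredM // mxE rpred_sum // => i _.
  by rewrite rpredM // mxE; apply: Ox.
have [c Dc] := fin_all_exists (fun j => intrP (int_q j)).
(* The scaling factor is [|z|], so the coefficients absorb the sign of [z]. *)
exists (fun j => sgz z * c j); rewrite {1}Dq mulr_sumr; apply: eq_bigr => j _.
rewrite pmulrn abszEsg !rmorphM -!mulrA; congr (_ * _).
by rewrite /= !mulrzl -!scaler_int scalerA Dc.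
Qed.

End Embeddings.

(** * Units that are small outside a real place *)

Lemma pigeonhole (A B : finType) (f : A -> B) :
  (#|B| < #|A|)%N -> exists x y, x != y /\ f x = f y.
Proof.
move=> ltBA; have /injectivePn[x [y neq_xy eq_f]] : ~~ injectiveb f.
  by apply: contraL ltBA => /injectiveP/leq_card; rewrite -leqNgt.
by exists x, y.
Qed.

Lemma truncn_eq_dist (u v : algC) :
  0 <= u -> 0 <= v -> Num.truncn u = Num.truncn v -> `|u - v| < 1.
Proof.
move=> u0 v0 eq_uv; have /andP[u1 u2] := truncn_itv u0.
have /andP[v1 v2] := truncn_itv v0; rewrite eq_uv in u1 u2.
rewrite real_ltr_norml ?realB ?ger0_real //.
apply/andP; split.
  by rewrite ltrBrDl ltrBlDr (lt_le_trans v2) // -natr1 lerD2r.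
by rewrite ltrBlDl (lt_le_trans u2) // -natr1 lerD2r.
Qed.

(** Coefficients from 0 to H = T^(n-1) give (H+1)^n combinations. Each functional has values in an
    interval of length 2HC, cut into T^n pieces of length 2C/T, so there are at most T^(n(n-1)) =
    H^n cells; subtract two combinations in one cell. *)
Lemma small_combination (J : finType) n (L : J -> 'I_n -> algC) (C T : nat) :
  (#|J| < n)%N -> (0 < T)%N -> (forall j k, L j k \is Num.real) ->
  (forall j, \sum_k `|L j k| < C%:R) ->
  exists a : 'I_n -> int,
    [/\ exists k, a k != 0, forall k, (`|a k| <= T ^ n.-1)%N &
        forall j, `|\sum_k (a k)%:~R * L j k| * T%:R < (2 * C)%:R].
Proof.
move=> ltJn T0 Lreal ltLC; set H := (T ^ n.-1)%N.
have n0 : (0 < n)%N by apply: leq_ltn_trans ltJn.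
have H0 : (0 < H)%N by rewrite expn_gt0 T0.
pose y (f : {ffun 'I_n -> 'I_H.+1}) j := \sum_k (f k)%:R * L j k.
(* Shifted and rescaled so that the range is [0, T^n) and the pieces are the unit intervals. *)
pose u f j := (y f j + (H * C)%:R) * (T%:R / (2 * C)%:R).
have C0 (j : J) : 0 < C%:R :> algC.
  by rewrite (le_lt_trans _ (ltLC j)) ?sumr_ge0.
have w0 (j : J) : 0 < T%:R / (2 * C)%:R :> algC.
  by rewrite divr_gt0 ?ltr0n // muln_gt0 /= -(ltr0n algC) (C0 j).
have y_real f j : y f j \is Num.real.
  by rewrite sum_real // => k _; rewrite realM ?realn.
have y_lt f j : `|y f j| < (H * C)%:R.
  apply: (@le_lt_trans _ _ (H%:R * \sum_k `|L j k|)).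
    rewrite mulr_sumr (le_trans (ler_norm_sum _ _ _)) // ler_sum // => k _.
    by rewrite normrM normr_nat ler_wpM2r ?ler_nat // -ltnS.
  by rewrite natrM ltr_pM2l ?ltr0n.
have u_ge0 f j : 0 <= u f j.
  rewrite mulr_ge0 ?(ltW (w0 j)) // -lerBlDr sub0r.
  by have := ltW (y_lt f j); rewrite real_ler_norml // => /andP[].
have u_lt f j : u f j < (T ^ n)%:R.
  have -> : (T ^ n)%:R = (2 * (H * C))%:R * (T%:R / (2 * C)%:R) :> algC.
    rewrite -(prednK n0) expnSr /= -/H !natrM invfM.
    have Cn0 := lt0r_neq0 (C0 j); have n2 : 2 != 0 :> algC by rewrite pnatr_eq0.
    by field; rewrite Cn0.
  rewrite ltr_pM2r ?(w0 j) // mul2n -addnn natrD ltrD2r.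
  by have := y_lt f j; rewrite real_ltr_norml // => /andP[].
have T1 : (0 < T ^ n)%N by rewrite expn_gt0 T0.
pose cell f : {ffun J -> 'I_(T ^ n)} :=
  [ffun j => Ordinal (ltn_pmod (Num.truncn (u f j)) T1)].
have [|f [g [neq_fg eq_fg]]] := @pigeonhole _ _ cell.
  rewrite !card_ffun !card_ord.
  apply: (@leq_ltn_trans (H ^ n)).
    rewrite /H -!expnM mulnC [(_.-1 * n)%N]mulnC leq_pexp2l //.
    by rewrite mulnC leq_mul2l -ltnS (prednK n0) ltJn orbT.
  by rewrite ltn_exp2r.
exists (fun k => (f k)%:Z - (g k)%:Z); split.
- have [k neq_k] : exists k, f k != g k.
    apply/existsP; apply: contraNT neq_fg; rewrite negb_exists => /forallP eqk.
    by apply/eqP/ffunP=> k; apply/eqP; rewrite -[_ == _]negbK eqk.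
  by exists k; rewrite subr_eq0 -val_eqE in neq_k *.
- by move=> k; have := ltn_ord (f k); have := ltn_ord (g k); lia.
move=> j; have := congr1 (fun c : {ffun J -> 'I_(T ^ n)} => val (c j)) eq_fg.
rewrite !ffunE /= !modn_small; last 2 first.
- by rewrite truncn_lt_nat.
- by rewrite truncn_lt_nat.
move=> /(truncn_eq_dist (u_ge0 f j) (u_ge0 g j)).
have -> : u f j - u g j =
    (\sum_k ((f k)%:Z - (g k)%:Z)%:~R * L j k) * (T%:R / (2 * C)%:R).
  rewrite -mulrBl opprD addrACA subrr addr0 -sumrB; congr (_ * _).
  by apply: eq_bigr => k _; rewrite rmorphB mulrBl.
rewrite normrM (gtr0_norm (w0 j)) mulrA ltr_pdivrMr ?mul1r //.
by rewrite ltr0n muln_gt0 /= -(ltr0n algC) (C0 j).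
Qed.

(** The outer reduction is the one performed by the ordinals built from [ltn_pmod]; it changes
    nothing. *)
Lemma residue_eq (m : nat) (x y : int) : (0 < m)%N ->
  (`|(x %% m)%Z| %% m)%N = (`|(y %% m)%Z| %% m)%N -> (m %| x - y)%Z.
Proof.
move=> m0; have mz0 : m%:Z != 0 by rewrite eqz_nat -lt0n.
have lt_m z : (`|(z %% m)%Z| < m)%N.
  by rewrite -ltz_nat gez0_abs ?modz_ge0 // (lt_le_trans (ltz_mod z mz0)).
rewrite !modn_small ?lt_m // => /(congr1 Posz).
by rewrite !gez0_abs ?modz_ge0 // => /eqP; rewrite eqz_mod_dvd.
Qed.

Lemma normC_Im_le (z : algC) : `|'Im z| <= `|z|.
Proof.
rewrite -(@ler_pXn2r _ 2) ?nnegrE ?normr_ge0 //.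
rewrite real_normK ?Creal_Im // normC2_Re_Im lerDr.
by rewrite real_exprn_even_ge0 ?Creal_Re.
Qed.

(** Conjugation changes the sign of the imaginary part, so Re and Im are the half sum and half
    difference of the two values on the right. *)
Lemma normC_le_Re_Im_conj (z : algC) :
  `|z| <= `|'Re z + 'Im z| + `|'Re z^* + 'Im z^* |.
Proof.
have re_z : 'Re z = (('Re z + 'Im z) + ('Re z^* + 'Im z^* )) / 2.
  by rewrite Re_conj Im_conj; field.
have im_z : 'Im z = (('Re z + 'Im z) - ('Re z^* + 'Im z^* )) / 2.
  by rewrite Re_conj Im_conj; field.
rewrite {1}[z]Crect (le_trans (ler_normD _ _)) // normrM normCi mul1r.
move: ('Re z + _) ('Re z^* + _) re_z im_z => a b -> ->.
rewrite !normrM normfV normr_nat -mulrDl ler_pdivrMr ?ltr0n //.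
by rewrite mulr_natr mulr2n lerD // ?ler_normD ?ler_normB.
Qed.

Lemma natr_bound (I : finType) (x : I -> algC) :
  exists C : nat, \sum_i `|x i| < C%:R.
Proof.
exists (Num.bound (\sum_i `|x i|)); rewrite archi_boundP // sumr_ge0 //.
Qed.

Section Units.

Variables (F : fieldExtType rat).
Let n := \dim {:F}.
Variable e : 'I_n -> {rmorphism F -> algC}.
Hypothesis e_onto : forall tau : {rmorphism F -> algC}, exists i, tau =1 e i.
Variable theta : F.
Hypothesis e_inj : injective (fun i => e i theta).
Variable B : 'I_n -> F.
Hypothesis B_int : forall j, in_OF (B j).
Hypothesis B_span : forall x, exists q : 'I_n -> rat, x = \sum_j q j *: B j.
Hypothesis B_free :
  forall q : 'I_n -> rat, \sum_j q j *: B j = 0 -> forall j, q j = 0.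

Definition lattice_elt (a : 'I_n -> int) : F := \sum_k (a k)%:~R * B k.

Lemma lattice_elt_int a : in_OF (lattice_elt a).
Proof. by apply: in_OF_sum => k; apply: in_OFM; [apply: in_OF_int|]. Qed.

Lemma lattice_elt_neq0 a k : a k != 0 -> lattice_elt a != 0.
Proof.
apply: contraNneq => a0.
have : \sum_k (a k)%:~R *: B k = 0.
  by rewrite -[RHS]a0; apply: eq_bigr => l _; rewrite mulrzl scaler_int.
by move=> /(B_free (q := fun k => (a k)%:~R))/(_ k)/eqP; rewrite intr_eq0.
Qed.

Lemma emb_lattice_elt i a : e i (lattice_elt a) = \sum_k (a k)%:~R * e i (B k).
Proof.
by rewrite rmorph_sum; apply: eq_bigr => k _; rewrite rmorphM rmorph_int.
Qed.

Lemma conj_emb i : exists j, forall x, e j x = (e i x)^*.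
Proof.
by have [j Dj] := e_onto (Num.conj \o e i); exists j => x; rewrite -Dj.
Qed.

Variable i0 : 'I_n.
Hypothesis i0_real : real_emb (e i0).

Lemma conj_emb_neq i j :
  i != i0 -> (forall x, e j x = (e i x)^*) -> j != i0.
Proof.
move=> neq_i Dj; apply: contraNneq neq_i => eq_j; apply/eqP/e_inj.
apply: (inv_inj (@conjCK algC)); rewrite -Dj eq_j.
by rewrite (CrealP (i0_real theta)).
Qed.

(* Minkowski-type pigeonhole on the real functionals Re (e j) + Im (e j),
   j != i0, which treat real and complex embeddings alike. *)
Lemma small_lattice_elt : exists N : nat, forall eps : algC, 0 < eps ->
  exists a, [/\ lattice_elt a != 0, `|emb_norm e (lattice_elt a)| <= N%:R &
                forall j, j != i0 -> `|e j (lattice_elt a)| < eps].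
Proof.
have n0 : (0 < n)%N by rewrite adim_gt0.
pose ell j x := 'Re (e j x) + 'Im (e j x).
have [C0 ltC0] := natr_bound (fun jk : 'I_n * 'I_n => e jk.1 (B jk.2)).
pose C := (2 * C0)%N.
have rowC j : \sum_k `|e j (B k)| < C0%:R.
  apply: le_lt_trans ltC0.
  rewrite -(pair_bigA _ (fun j k => `|e j (B k)|)) /= [leRHS](bigD1 j) //=.
  rewrite lerDl.
  by rewrite sumr_ge0 // => *; apply: sumr_ge0.
(* The absolute value at [i0] is at most C T^(n-1) and the other n-1 are below 4C/T, so [T], hence
   [eps], cancels in the norm. *)
exists (C * (4 * C) ^ n.-1)%N => eps eps0.
have eps_real := ger0_real (ltW eps0).
pose T := (Num.bound ((4 * C)%:R / eps)).+1.
have T0 : (0 < T)%N by [].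
have ltT : (4 * C)%:R < eps * T%:R.
  rewrite mulrC -ltr_pdivrMr // (lt_le_trans (archi_boundP _)) //.
    by rewrite divr_ge0 ?ler0n ?ltW.
  by rewrite ler_nat.
pose J := {j : 'I_n | j != i0}.
have cardJ : (#|{: J}| = n.-1)%N by rewrite card_sig cardC1 card_ord.
have [] := @small_combination J n (fun j k => ell (val j) (B k)) C T.
- by rewrite cardJ prednK.
- by [].
- by move=> j k; rewrite realD ?Creal_Re ?Creal_Im.
- move=> j; rewrite natrM.
  apply: (@le_lt_trans _ _ (2 * \sum_k `|e (val j) (B k)|)).
    rewrite mulr_sumr ler_sum // => k _; rewrite (le_trans (ler_normD _ _)) //.
    by rewrite mulr_natl mulr2n lerD ?leif_normC_Re_Creal ?normC_Im_le.
  by rewrite ltr_pM2l ?ltr0n.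
move=> a [[k ak0] leH small]; exists a.
have ellE j : ell j (lattice_elt a) = \sum_k (a k)%:~R * ell j (B k).
  rewrite /ell emb_lattice_elt !raddf_sum -big_split; apply: eq_bigr => k' _.
  by rewrite mulrDr !mulrzl !raddfMz.
(* The bounds 2C/T for the functionals at [j] and at its conjugate place [j'] add up. *)
have smallT j : j != i0 -> `|e j (lattice_elt a)| * T%:R < (4 * C)%:R.
  move=> neq_j; have [j' Dj'] := conj_emb j.
  have neq_j' := conj_emb_neq neq_j Dj'.
  have := small (exist _ j neq_j); have := small (exist _ j' neq_j').
  rewrite /= -!ellE => s1 s2.
  apply: (@le_lt_trans _ _
    ((`|ell j (lattice_elt a)| + `|ell j' (lattice_elt a)|) * T%:R)).
    by rewrite ler_wpM2r ?ler0n // /ell !Dj' normC_le_Re_Im_conj.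
  have -> : (4 * C = 2 * C + 2 * C)%N by lia.
  by rewrite mulrDl natrD ltrD.
have a0 := lattice_elt_neq0 ak0; split=> //; last first.
  move=> j neq_j; rewrite -(ltr_pM2r (_ : 0 < T%:R)) ?ltr0n //.
  exact: lt_trans (smallT j neq_j) ltT.
rewrite /emb_norm (bigD1 i0) //= normrM normr_prod.
have Tn0 : 0 < T%:R ^+ n.-1 :> algC by rewrite exprn_gt0 ?ltr0n.
have card_neq : #|[pred j : 'I_n | j != i0]| = n.-1 by rewrite cardC1 card_ord.
have b1 : `|e i0 (lattice_elt a)| <= C%:R * T%:R ^+ n.-1.
  rewrite emb_lattice_elt (le_trans (ler_norm_sum _ _ _)) // mulrC.
  apply: (@le_trans _ _ (T%:R ^+ n.-1 * \sum_k `|e i0 (B k)|)).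
    rewrite mulr_sumr ler_sum // => l _; rewrite normrM ler_wpM2r //.
    by rewrite -intr_norm -abszE -pmulrn -natrX ler_nat leH.
  rewrite ler_wpM2l ?(ltW Tn0) // (le_trans (ltW (rowC i0))) //.
  by rewrite ler_nat leq_pmull.
have b2 : (\prod_(j | j != i0) `|e j (lattice_elt a)|) * T%:R ^+ n.-1
    <= (4 * C)%:R ^+ n.-1.
  rewrite -card_neq -!prodr_const -big_split /= ler_prod // => j neq_j.
  by rewrite mulr_ge0 ?ler0n // ltW ?smallT.
rewrite -(ler_pM2r Tn0) natrM natrX -mulrA [leRHS]mulrAC.
by rewrite ler_pM // ?mulr_ge0 ?prodr_ge0 ?(ltW Tn0).
Qed.

(* Among elements of bounded norm with strictly decreasing absolute values
   outside i0, two are congruent modulo N!; their ratio is the unit. *)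
Lemma small_unit : exists u : F,
  [/\ u != 0, in_OF u, in_OF u^-1 & forall j, j != i0 -> `|e j u| < 1].
Proof.
have [N smallN] := small_lattice_elt.
pose elt (a : {ffun 'I_n -> int}) := lattice_elt a.
pose good a := (elt a != 0) && (`|emb_norm e (elt a)| <= N%:R).
pose lt_elt (a b : {ffun 'I_n -> int}) :=
  [forall (j | j != i0), `|e j (elt a)| < `|e j (elt b)|].
have lt_trans_elt : transitive lt_elt.
  move=> b a c /forall_inP ltab /forall_inP ltbc; apply/forall_inP=> j neq_j.
  exact: lt_trans (ltab j neq_j) (ltbc j neq_j).
(* Each new element is put in front and chosen with [eps] below every conjugate of the previous
   one. *)
have chain K : exists s : seq {ffun 'I_n -> int},
    [/\ size s = K.+1, all good s & sorted lt_elt s].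
  elim: K => [|K [s [sz_s good_s lt_s]]].
    have [a [a0 leN _]] := smallN 1 ltr01; exists [:: [ffun k => a k]].
    have Da : elt [ffun k => a k] = lattice_elt a.
      by apply: eq_bigr => k _; rewrite ffunE.
    by rewrite /= /good Da a0 leN.
  case: s sz_s good_s lt_s => [|b s] // sz_s good_s lt_s.
  have /andP[b0 _] := allP good_s b (mem_head _ _).
  have [eps eps0 le_eps] :
      exists2 eps : algC, 0 < eps & forall j, eps <= `|e j (elt b)|.
    have inv_ge0 (Q : pred 'I_n) : 0 <= \sum_(j | Q j) `|e j (elt b)|^-1.
      by rewrite sumr_ge0 // => j _; rewrite invr_ge0.
    have S0 : 0 < 1 + \sum_j `|e j (elt b)|^-1 by rewrite ltr_pwDl ?ltr01.
    (* An explicit positive lower bound for all the [|e j (elt b)|]. *)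
    exists (1 + \sum_j `|e j (elt b)|^-1)^-1; first by rewrite invr_gt0.
    move=> j; have ej0 : 0 < `|e j (elt b)| by rewrite normr_gt0 fmorph_eq0.
    rewrite -[leRHS]invrK lef_pV2 ?posrE ?invr_gt0 //.
    by rewrite (bigD1 j) //= addrCA lerDl addr_ge0.
  have [a [a0 leN lta]] := smallN eps eps0.
  have Da : elt [ffun k => a k] = lattice_elt a.
    by apply: eq_bigr => k _; rewrite ffunE.
  exists ([ffun k => a k] :: b :: s); split; first by rewrite /= -sz_s.
    by move: good_s; rewrite /= /good Da a0 leN.
  rewrite /= in lt_s *; rewrite lt_s andbT; apply/forall_inP=> j neq_j.
  by rewrite Da (lt_le_trans (lta j neq_j)).
pose m := N`!; have m0 : (0 < m)%N by rewrite fact_gt0.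
pose res (a : {ffun 'I_n -> int}) : {ffun 'I_n -> 'I_m} :=
  [ffun k => Ordinal (ltn_pmod `|(a k %% m)%Z|%N m0)].
(* The chain has one element more than there are residue vectors. *)
have [s [sz_s good_s sorted_s]] := chain #|{ffun 'I_n -> 'I_m}|.
have /(uniqPn (res 0))[i [j [ltij]]] : ~~ uniq (map res s).
  apply/negP=> /card_uniqP; rewrite size_map sz_s => card_res.
  by have := max_card (mem (map res s)); rewrite card_res ltnn.
rewrite size_map => ltj eq_res; have lti := ltn_trans ltij ltj.
rewrite !(nth_map 0) // in eq_res.
have lt_ab : lt_elt s`_i s`_j.
  have := sorted_ltn_nth lt_trans_elt 0 sorted_s; apply=> //.
have /andP[] := allP good_s _ (mem_nth 0 lti).
have /andP[] := allP good_s _ (mem_nth 0 ltj).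
move: s`_i s`_j lt_ab eq_res => a b lt_ab eq_res b0 leNb a0 leNa.
have [c Oc Dab] : exists2 c, in_OF c & elt a - elt b = m%:R * c.
  exists (lattice_elt (fun k => ((a k - b k) %/ m)%Z)).
    exact: lattice_elt_int.
  rewrite /elt /lattice_elt -sumrB mulr_sumr; apply: eq_bigr => k _.
  rewrite mulrA -mulrBl; congr (_ * _).
  have dvd_m : (m %| a k - b k)%Z.
    have := congr1 (fun f : {ffun 'I_n -> 'I_m} => val (f k)) eq_res.
    by rewrite !ffunE => /(residue_eq m0).
  by rewrite -rmorphB -{1}(divzK dvd_m) rmorphM mulrC.
(* Here x/y = 1 + (m/y) d, and m/y is integral because m = N!. Used in both directions, this makes
   the quotient a unit. *)
have ratio x y d : y != 0 -> in_OF y -> `|emb_norm e y| <= N%:R ->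
    in_OF d -> x - y = m%:R * d -> in_OF (x / y).
  move=> y0 Oy leN Od Dxy.
  have -> : x / y = 1 + m%:R / y * d.
    by rewrite mulrAC -Dxy mulrBl divff // addrC subrK.
  apply: in_OFD; first exact: in_OF1.
  apply: in_OFM => //.
  exact: (in_OF_fact_div e_onto e_inj B_span).
exists (elt a / elt b); split.
- by rewrite mulf_neq0 ?invr_eq0.
- by apply: (ratio _ _ c) => //; apply: lattice_elt_int.
- rewrite invf_div; apply: (ratio _ _ (- c)) => //; try exact: lattice_elt_int.
    rewrite -mulN1r -(rmorphN1 (intr : int -> F)).
    by apply: in_OFM => //; apply: in_OF_int.
  by rewrite mulrN -Dab opprB.
move=> l neq_l; rewrite rmorphM fmorphV normrM normfV.
rewrite ltr_pdivrMr ?normr_gt0 ?fmorph_eq0 // mul1r.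
exact: (forall_inP lt_ab).
Qed.
End Units.

(** * Multiplicative relations between units *)

Section Independence.

Variables (F : fieldExtType rat).
Let n := \dim {:F}.
Variable e : 'I_n -> {rmorphism F -> algC}.

Lemma emb_norm_lt1 x : (forall j, `|e j x| < 1) -> `|emb_norm e x| < 1.
Proof.
move=> ltx; have n0 : (0 < n)%N by rewrite adim_gt0.
rewrite /emb_norm (bigD1 (Ordinal n0)) //= normrM normr_prod.
rewrite (le_lt_trans (ler_piMr _ _)) ?ltx //.
by apply: prodr_ile1 => j _; rewrite normr_ge0 ltW ?ltx.
Qed.

(* c j = Some k marks the places where w k may be large.  If the positive and
   the negative part of a relation were both nontrivial, their common value
   would be small at every place, against the product formula. *)
Lemma multiplicatively_independent (I : finType) (w : I -> F)
    (c : 'I_n -> option I) (j0 : 'I_n) :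
  (forall k, w k != 0) -> (forall k, `|emb_norm e (w k)| = 1) ->
  (forall k j, c j != Some k -> `|e j (w k)| < 1) -> c j0 = None ->
  forall z : I -> int, \prod_k w k ^ z k = 1 -> forall k, z k = 0.
Proof.
move=> w0 Nw w_lt cj0 z prod1.
(* The relation says that the parts with positive and with negative exponents coincide. *)
pose part (S : pred I) := \prod_(k | S k) w k ^+ `|z k|.
have small (S : pred I) k j : (forall k, S k -> z k != 0) -> S k ->
    (forall k, S k -> c j != Some k) -> `|e j (part S)| < 1.
  move=> Sz Sk Sc; rewrite /part (bigD1 k) //= rmorphM normrM.
  have ltX l : S l -> `|e j (w l ^+ `|z l|)| < 1.
    move=> Sl; rewrite rmorphXn normrX exprn_ilt1 ?w_lt ?Sc //.
    by rewrite -lt0n absz_gt0 Sz.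
  rewrite (le_lt_trans (ler_piMr _ _)) ?ltX // rmorph_prod normr_prod.
  by apply: prodr_ile1 => l /andP[Sl _]; rewrite normr_ge0 ltW ?ltX.
pose P k := 0 < z k; pose Q k := z k < 0.
have Pz k : P k -> z k != 0 by move=> /lt0r_neq0.
have Qz k : Q k -> z k != 0 by move=> /ltr0_neq0.
have partPQ : part P = part Q.
  have Q0 : part Q != 0 by apply/prodf_neq0 => k _; rewrite expf_neq0.
  apply: (mulIf (_ : (part Q)^-1 != 0)); first by rewrite invr_eq0.
  rewrite divff // -prod1 [RHS](bigID P) /= -prodfV; congr (_ * _).
    by apply: eq_bigr => k Pk; rewrite -{2}[z k]gez0_abs ?ltW.
  rewrite [RHS](bigID Q) /= [X in _ = _ * X]big1 ?mulr1.
    apply: eq_big => [k|k Qk]; first by rewrite /P /Q -leNgt; case: ltrgtP.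
    by rewrite -[z k in RHS]opprK -(ltz0_abs (Qk : z k < 0)) -exprnN.
  move=> k; rewrite /P /Q -!leNgt -eq_le eq_sym => /eqP <-.
  by rewrite expr0z.
(* No [w k] is large at [j0], so a nonempty part is small there and is not 1; hence both parts are
   empty or neither is. *)
have not_small (S : pred I) k : (forall k, S k -> z k != 0) -> S k ->
    part S != 1.
  move=> Sz Sk; apply: contraTneq (small S k j0 Sz Sk _) => [->|l _].
    by rewrite rmorph1 normr1 ltxx.
  by rewrite cj0.
case: (pickP P) => [k Pk|noP]; last first.
  case: (pickP Q) => [k Qk|noQ] k'; last first.
    by apply/eqP; rewrite eq_le leNgt [0 < _]noP leNgt [_ < 0]noQ.
  by case/eqP: (not_small Q k Qz Qk); rewrite -partPQ /part big_pred0.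
case: (pickP Q) => [l Ql|noQ]; last first.
  by case/eqP: (not_small P k Pz Pk); rewrite partPQ /part big_pred0.
have : `|emb_norm e (part P)| < 1.
  apply: emb_norm_lt1 => j.
  (* At the place [j] use whichever part omits the index marked by [c j]. *)
  have [/existsP[i /andP[Pi ci]]|noc] :=
    boolP [exists i, P i && (c j == Some i)].
    rewrite partPQ; apply: (small _ _ _ Qz Ql) => i' Qi'; rewrite (eqP ci).
    apply: contraTneq Pi => -[->]; by rewrite /P -leNgt ltW.
  apply: (small _ _ _ Pz Pk) => i Pi; apply: contra noc => ci.
  by apply/existsP; exists i; rewrite Pi.
rewrite /part /emb_norm; under eq_bigr do rewrite rmorph_prod.
rewrite exchange_big normr_prod /= big1 ?ltxx // => i _.
under eq_bigr do rewrite rmorphXn.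
by rewrite prodrXl normrX Nw expr1n.
Qed.

End Independence.

(** Both numbers lie in the same dyadic interval from 2^t to 2^(t+1). *)
Lemma log_cell (x y : algC) : 1 <= x -> 1 <= y ->
  trunc_log 2 (Num.truncn x) = trunc_log 2 (Num.truncn y) -> x <= 2 * y.
Proof.
have log_itv u : 1 <= u -> (2 ^ trunc_log 2 (Num.truncn u))%:R <= u /\
    u < (2 ^ (trunc_log 2 (Num.truncn u)).+1)%:R.
  move=> u1; have u0 := le_trans ler01 u1.
  have /andP[le_u lt_u] := truncn_itv u0.
  have tr0 : (0 < Num.truncn u)%N by rewrite truncn_gt0.
  split; first by rewrite (le_trans _ le_u) // ler_nat trunc_logP.
  by rewrite (lt_le_trans lt_u) // ler_nat trunc_log_ltn.
move=> /log_itv[_ ltx] /log_itv[ley _] eq_log; rewrite (le_trans (ltW ltx)) //.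
by rewrite eq_log expnS natrM ler_pM2l ?ltr0n.
Qed.

Section Relations.

Variables (F : fieldExtType rat).
Let n := \dim {:F}.
Variable e : 'I_n -> {rmorphism F -> algC}.
Hypothesis e_onto : forall tau : {rmorphism F -> algC}, exists i, tau =1 e i.
Variable theta : F.
Hypothesis e_inj : injective (fun i => e i theta).
Variable B : 'I_n -> F.
Hypothesis B_int : forall j, in_OF (B j).
Hypothesis B_span : forall x, exists q : 'I_n -> rat, x = \sum_j q j *: B j.

(* Pigeonhole on the monomials in the w k with exponents below N: their
   logarithms at the places of J fall into O(N)^#|J| unit boxes.  Two monomials
   in one box and congruent modulo a large integer are equal. *)
Lemma multiplicatively_dependent (I : finType) (w : I -> F) (J : {set 'I_n}) :
  (forall k, [/\ w k != 0, in_OF (w k) & in_OF (w k)^-1]) ->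
  (forall z : I -> int, let v := \prod_k w k ^ z k in
     (forall j, j \in J -> 2^-1 <= `|e j v| <= 2) ->
     forall i, `|e i v| <= 2 ^+ n) ->
  (#|J| < #|I|)%N ->
  exists z : I -> int, (exists k, z k != 0) /\ \prod_k w k ^ z k = 1.
Proof.
move=> wU wJ ltJI.
have w0 k : w k != 0 by case: (wU k).
have [D0 D0_gt0 D0P] := disc_scaling e_inj B_int B_span.
(* It exceeds 2^n + 1, which bounds every conjugate of [v - 1] when those of [v] are at most 2^n. *)
pose m := (2 ^ n + 2)%N; have m0 : (0 < m)%N by rewrite addn_gt0 orbT.
have D0m_gt0 : (0 < D0 * m)%N by rewrite muln_gt0 D0_gt0.
have [D1 ltD1] := natr_bound (fun jk : 'I_n * I => e jk.1 (w jk.2)).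
have [D2 ltD2] := natr_bound (fun jk : 'I_n * I => e jk.1 (w jk.2)^-1).
pose D := (D1 + D2)%N.
have term_le (x : 'I_n * I -> algC) C : \sum_p `|x p| < C%:R ->
    (C <= D)%N -> forall p, `|x p| <= 2 ^+ D.
  move=> ltC leCD p; have leX : `|x p| <= C%:R.
    by rewrite (le_trans _ (ltW ltC)) // (bigD1 p) //= lerDl sumr_ge0.
  rewrite (le_trans leX) // -natrX ler_nat (leq_trans leCD) // ltnW //.
  exact: ltn_expl.
have w_le j k : `|e j (w k)| <= 2 ^+ D.
  exact: (term_le _ _ ltD1 (leq_addr _ _) (j, k)).
have wV_le j k : `|e j (w k)^-1| <= 2 ^+ D.
  exact: (term_le _ _ ltD2 (leq_addl _ _) (j, k)).
pose r := #|J|; pose a := (2 * (D * #|I|)).+1.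
(* With 2E+1 <= aN there are at most (aN)^r (D0 m)^n < N^(r+1) cells, and at least N^(r+1)
   monomials. *)
pose N := (a ^ r * (D0 * m) ^ n).+1.
pose E := (D * #|I| * N)%N.
pose W (f : {ffun I -> 'I_N}) := \prod_k w k ^+ f k.
have W0 f : W f != 0 by apply/prodf_neq0 => k _; rewrite expf_neq0.
have OW f : in_OF (W f).
  by apply: in_OF_prod => k; apply: in_OFX; case: (wU k).
have OWV f : in_OF (W f)^-1.
  rewrite -prodfV; apply: in_OF_prod => k; rewrite -exprVn; apply: in_OFX.
  by case: (wU k).
have pow_le j (x : I -> F) (f : {ffun I -> 'I_N}) :
    (forall k, `|e j (x k)| <= 2 ^+ D) ->
    `|e j (\prod_k x k ^+ val (f k))| <= 2 ^+ E.
  move=> le_x; rewrite rmorph_prod normr_prod.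
  have -> : 2 ^+ E = \prod_(k : I) 2 ^+ (D * N) :> algC.
    by rewrite prodr_const -exprM /E mulnAC.
  apply: ler_prod => k _; rewrite normr_ge0 rmorphXn normrX exprM /=.
  apply: (@le_trans _ _ ((2 ^+ D) ^+ f k)).
    by apply: lerXn2r; rewrite ?nnegrE ?exprn_ge0 ?ler0n.
  by rewrite ler_weXn2l ?exprn_ege1 ?ler1n // ltnW.
(* As 2^E bounds the conjugates of [W f] and of its inverse, this factor moves the absolute values
   into [1, 2^(2E)], where [trunc_log] applies. *)
pose X j f := `|e j (W f)| * 2 ^+ E.
have X_ge1 j f : 1 <= X j f.
  have -> : 1 = `|e j (W f)| * `|e j (W f)^-1|.
    by rewrite -normrM -rmorphM divff // rmorph1 normr1.
  rewrite ler_wpM2l // -prodfV; under eq_bigr do rewrite -exprVn.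
  exact: pow_le.
have X_le j f : X j f <= (2 ^ (2 * E))%:R.
  by rewrite natrX mul2n -addnn exprD ler_wpM2r ?exprn_ge0 ?ler0n ?pow_le.
have log_lt j f : (trunc_log 2 (Num.truncn (X j f)) < (2 * E).+1)%N.
  rewrite ltnS -[leqRHS](@trunc_expnK 2) // leq_trunc_log //.
  by have := le_truncn (X_le j f); rewrite natrK.
have [c Dc] := fin_all_exists (fun f => D0P _ (OW f)).
pose cell f : {ffun {j | j \in J} -> 'I_(2 * E).+1} :=
  [ffun j => inord (trunc_log 2 (Num.truncn (X (val j) f)))].
(* Only [D0 * W f] has integer coordinates in [B]; equality modulo [D0 * m] becomes a congruence
   modulo [m] once [D0] is cancelled. *)
pose res f : {ffun 'I_n -> 'I_(D0 * m)} :=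
  [ffun k => Ordinal (ltn_pmod `|(c f k %% (D0 * m)%N)%Z|%N D0m_gt0)].
have [|f [g [neq_fg [eq_cell eq_res]]]] :=
  @pigeonhole _ _ (fun f => (cell f, res f)).
  rewrite card_prod !card_ffun !card_ord card_sig -/r.
  apply: (@leq_ltn_trans ((a * N) ^ r * (D0 * m) ^ n)).
    rewrite leq_mul2r; apply/orP; right; case: (r) => // r'.
    by rewrite leq_exp2r // /a /E [leqRHS]mulSn -(mulnA 2%N) -add1n leq_add.
  rewrite expnMn mulnAC; apply: (@leq_trans (N ^ r.+1)).
    by rewrite expnSr mulnC ltn_pmul2l ?expn_gt0.
  by rewrite leq_pexp2l.
pose z k := (f k)%:Z - (g k)%:Z.
have Dv : \prod_k w k ^ z k = W f / W g.
  rewrite -prodfV -big_split; apply: eq_bigr => k _.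
  by rewrite /z expfzDr // -exprnN.
have v_le i : `|e i (W f / W g)| <= 2 ^+ n.
  rewrite -Dv; apply: wJ => j jJ; rewrite Dv.
  have eq_log :
      trunc_log 2 (Num.truncn (X j f)) = trunc_log 2 (Num.truncn (X j g)).
    have := congr1 (fun h : {ffun _ -> 'I_(2 * E).+1} =>
      val (h (exist _ j jJ))) eq_cell.
    by rewrite !ffunE /= !inordK ?log_lt.
  have Xg0 : 0 < X j g by apply: lt_le_trans ltr01 (X_ge1 j g).
  have -> : `|e j (W f / W g)| = X j f / X j g.
    rewrite rmorphM fmorphV normrM normfV /X invfM mulrACA divff ?mulr1 //.
    by rewrite expf_neq0 // pnatr_eq0.
  rewrite ler_pdivlMr // ler_pdivrMl ?ltr0n // ler_pdivrMr //.
  by rewrite !log_cell // X_ge1.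
exists z; split.
  have [k neq_k] : exists k, f k != g k.
    apply/existsP; apply: contraNT neq_fg; rewrite negb_exists => /forallP eqk.
    by apply/eqP/ffunP=> k; apply/eqP; rewrite -[_ == _]negbK eqk.
  by exists k; rewrite subr_eq0 -val_eqE in neq_k *.
have [d Od Dd] : exists2 d, in_OF d & W f - W g = m%:R * d.
  exists (lattice_elt B (fun k => ((c f k - c g k) %/ (D0 * m)%N)%Z)).
    exact: lattice_elt_int.
  have n0 : (0 < n)%N by rewrite adim_gt0.
  have D0F : D0%:R != 0 :> F.
    by rewrite -(fmorph_eq0 (e (Ordinal n0))) rmorph_nat pnatr_eq0 -lt0n.
  apply: (mulfI D0F); rewrite mulrBr !Dc mulrA -natrM -sumrB mulr_sumr.
  apply: eq_bigr => k _; rewrite mulrA -mulrBl; congr (_ * _).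
  have dvd_m : ((D0 * m)%N %| c f k - c g k)%Z.
    have := congr1 (fun h : {ffun 'I_n -> 'I_(D0 * m)} => val (h k)) eq_res.
    by rewrite !ffunE => /(residue_eq D0m_gt0).
  by rewrite -rmorphB -{1}(divzK dvd_m) rmorphM mulrC.
(* Otherwise (v - 1)/m would be a nonzero algebraic integer with all conjugates below 1, so of norm
   below 1. *)
rewrite Dv; apply/eqP; rewrite -subr_eq0 -[_ == _]negbK; apply/negP=> x0.
have Dx : W f / W g - 1 = m%:R * (d / W g).
  by rewrite mulrA -Dd mulrBl (divff (W0 g)).
rewrite Dx in x0; have y0 : d / W g != 0.
  by apply: contraNneq x0 => ->; rewrite mulr0.
have := emb_norm_ge1 e_inj B_span (in_OFM Od (OWV g)) y0.
suff /lt_geF-> : `|emb_norm e (d / W g)| < 1 by [].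
apply: emb_norm_lt1 => i; have m_gt0 : 0 < m%:R :> algC by rewrite ltr0n.
rewrite -(ltr_pM2l m_gt0) -{1}[m%:R]normr_nat -(rmorph_nat (e i)) -normrM.
rewrite -rmorphM -Dx rmorphB rmorph1 mulr1 (le_lt_trans (ler_normB _ _)) //.
rewrite normr1 rmorph_nat natrD natrX (le_lt_trans (lerD (v_le i) (lexx 1))) //.
by rewrite ltrD2l ltr1n.
Qed.

End Relations.

(** * Ranks of dilation groups *)

Lemma has_rank_inj (S : algC -> Prop) r1 r2 :
  has_rank S r1 -> has_rank S r2 -> r1 = r2.
Proof.
move=> [[xs1 [<- [S1 ind1]]] le1] [[xs2 [<- [S2 ind2]]] le2].
by apply/eqP; rewrite eqn_leq le2 // le1.
Qed.

(** Passes from sequences to families indexed by finite types, the form in which the results on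
    units are stated. *)
Lemma has_rank_family (S : algC -> Prop) (I : finType) (x : I -> algC) :
  (forall k, S (x k)) ->
  (forall z : I -> int, \prod_k x k ^ z k = 1 -> forall k, z k = 0) ->
  (forall m (y : 'I_m -> algC), (forall k, S (y k)) -> (#|I| < m)%N ->
     exists z : 'I_m -> int, (exists k, z k != 0) /\ \prod_k y k ^ z k = 1) ->
  has_rank S #|I|.
Proof.
move=> Sx ind_x dep; split.
  exists [seq x k | k <- enum I]; rewrite size_map -cardE; split=> //.
  have nthx (i : 'I_#|I|) : [seq x k | k <- enum I]`_i = x (enum_val i).
    rewrite (nth_map (enum_val i)) -?cardE //; congr x.
    exact/esym/enum_val_nth.
  split=> [i lti|es sz_es]; first by rewrite (nthx (Ordinal lti)).
  rewrite size_map -cardE in sz_es *; move=> prod1 i.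
  have [lti|gei] := ltnP i #|I|; last by rewrite nth_default ?sz_es.
  have := @ind_x (fun k => es`_(enum_rank k)) _ (enum_val (Ordinal lti)).
  rewrite enum_valK; apply.
  rewrite -[RHS]prod1 (reindex (@enum_val I predT)) /=; last first.
    by exists enum_rank => k _; rewrite ?enum_valK ?enum_rankK.
  by apply: eq_bigr => k _; rewrite enum_valK nthx.
move=> xs Sxs ind_xs; rewrite leqNgt; apply/negP=> ltI.
have [|z [[k zk] prod1]] := dep (size xs) (fun i => xs`_i) _ ltI.
  by move=> i; apply: Sxs.
have nthz (i : 'I_(size xs)) : [seq z i | i <- enum 'I_(size xs)]`_i = z i.
  by rewrite (nth_map i) ?size_enum_ord // nth_ord_enum.
case/eqP: zk; rewrite -nthz; apply: ind_xs.
  by rewrite size_map size_enum_ord.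
by rewrite -[RHS]prod1; apply: eq_bigr => i _; rewrite nthz.
Qed.

Definition is_unit_OF (F : fieldExtType rat) (u : F) :=
  [/\ u != 0, in_OF u & in_OF u^-1].

Lemma is_unit_OFM (F : fieldExtType rat) (u v : F) :
  is_unit_OF u -> is_unit_OF v -> is_unit_OF (u * v).
Proof.
move=> [u0 Ou Ou'] [v0 Ov Ov']; split; first by rewrite mulf_neq0.
  exact: in_OFM.
by rewrite invfM; apply: in_OFM.
Qed.

Lemma is_unit_OFV (F : fieldExtType rat) (u : F) :
  is_unit_OF u -> is_unit_OF u^-1.
Proof. by case=> u0 Ou Ou'; split; rewrite ?invr_eq0 ?invrK. Qed.

Lemma is_unit_OF1 (F : fieldExtType rat) : is_unit_OF (1 : F).
Proof. by split; rewrite ?oner_neq0 ?invr1 //; apply: in_OF1. Qed.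

Lemma is_unit_OF_prod (F : fieldExtType rat) (I : finType) (u : I -> F)
    (z : I -> int) :
  (forall k, is_unit_OF (u k)) -> is_unit_OF (\prod_k u k ^ z k).
Proof.
move=> Uu; apply: big_ind => [|x y|k _]; first exact: is_unit_OF1.
  exact: is_unit_OFM.
have UX m : is_unit_OF (u k ^+ m).
  elim: m => [|m IH]; first exact: is_unit_OF1.
  by rewrite exprS; apply: is_unit_OFM.
case: (z k) => m; first exact: UX.
exact: is_unit_OFV.
Qed.

Lemma totpos_unit_is_unit (F : fieldExtType rat) (u : F) :
  totpos_unit u -> is_unit_OF u.
Proof. by case. Qed.

(** Squaring makes the units of [small_unit] totally positive and keeps their small conjugates
    small. *)
Lemma totpos_unit_sqr (F : fieldExtType rat) (u : F) :
  is_unit_OF u -> totpos_unit (u ^+ 2).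
Proof.
move=> Uu; have [u0 Ou Ou'] : is_unit_OF (u ^+ 2) by apply: is_unit_OFM.
split=> // s sR; rewrite rmorphXn /= real_exprn_even_gt0 //=.
  by move: u0; rewrite expf_eq0 fmorph_eq0.
Qed.

Lemma totpos_unit_prod (F : fieldExtType rat) (I : finType) (u : I -> F)
    (z : I -> int) :
  (forall k, totpos_unit (u k)) -> totpos_unit (\prod_k u k ^ z k).
Proof.
move=> Tu; have [|p0 Op Op'] := @is_unit_OF_prod F I u z.
  by move=> k; apply: totpos_unit_is_unit.
split=> // s sR; rewrite rmorph_prod prodr_gt0 // => k _.
have [_ _ _ pos_u] := Tu k.
by rewrite fmorphXz exprz_gt0 ?pos_u.
Qed.

(** * Fields with a single pair of complex embeddings *)

Section OneComplexPlace.

Variables (F : fieldExtType rat) (sigma : {rmorphism F -> algC}).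
Let n := \dim {:F}.
Hypothesis sigma_nonreal : ~ real_emb sigma.
Hypothesis only_sigma : forall tau : {rmorphism F -> algC}, ~ real_emb tau ->
  (forall x, tau x = sigma x) \/ (forall x, tau x = (sigma x)^*).
Variable e : 'I_n -> {rmorphism F -> algC}.
Hypothesis e_onto : forall tau : {rmorphism F -> algC}, exists i, tau =1 e i.
Variable theta : F.
Hypothesis e_inj : injective (fun i => e i theta).
Variable B : 'I_n -> F.
Hypothesis B_int : forall j, in_OF (B j).
Hypothesis B_span : forall x, exists q : 'I_n -> rat, x = \sum_j q j *: B j.
Hypothesis B_free :
  forall q : 'I_n -> rat, \sum_j q j *: B j = 0 -> forall j, q j = 0.
Variables a b : 'I_n.
Hypothesis a_sigma : sigma =1 e a.
Hypothesis b_sigma : forall x, (sigma x)^* = e b x.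

(** The real places, since [a] and [b] index [sigma] and its conjugate. *)
Let R : {set 'I_n} := ~: [set a; b].

Lemma complex_emb_neq : a != b.
Proof.
apply/eqP=> eq_ab; apply: sigma_nonreal => x.
by apply/CrealP; rewrite b_sigma -eq_ab -a_sigma.
Qed.

Lemma real_emb_in i : i \in R -> real_emb (e i).
Proof.
rewrite !inE negb_or => /andP[ia ib] x; apply/idPn => ix.
have : ~ real_emb (e i) by move/(_ x); apply/negP.
by case/only_sigma=> /(_ theta); rewrite ?b_sigma ?a_sigma => /e_inj ei;
  rewrite ei eqxx in ia ib.
Qed.

Lemma card_real_emb : #|R| = (n - 2)%N.
Proof. by rewrite cardsCs setCK cards2 complex_emb_neq card_ord. Qed.

Lemma norm_emb_b x : `|e b x| = `|sigma x|.
Proof. by rewrite -b_sigma norm_conjC. Qed.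

Lemma notin_R i : i \notin R -> forall x, `|e i x| = `|sigma x|.
Proof.
rewrite !inE negbK => /orP[]/eqP-> x; first by rewrite -a_sigma.
exact: norm_emb_b.
Qed.

(** By the product formula [|sigma v| ^+ 2] is the inverse of the product over the real places,
    which is at least 2^-(n-2). This lets [multiplicatively_dependent] run with the real places
    alone. *)
Lemma unit_bounded v : is_unit_OF v ->
  (forall j, j \in R -> 2^-1 <= `|e j v| <= 2) ->
  forall i, `|e i v| <= 2 ^+ n.
Proof.
move=> [v0 Ov Ov'] vR i; have n0 : (0 < n)%N by rewrite adim_gt0.
have [iR|/notin_R->] := boolP (i \in R).
  have /andP[_ /le_trans->] := vR i iR => //.
  by rewrite -[leLHS]expr1 ler_weXn2l ?ler1n.
rewrite -(@ler_pXn2r _ 2) ?nnegrE ?exprn_ge0 ?ler0n //.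
have := norm_emb_norm_unit e_inj B_span v0 Ov Ov'.
rewrite /emb_norm (bigD1 a) //= (bigD1 b) ?[b == a]eq_sym ?complex_emb_neq //=.
rewrite !normrM norm_emb_b -a_sigma mulrA -expr2 normr_prod => prod1.
have le_inv : (2 ^+ n)^-1 <= \prod_(j | (j != a) && (j != b)) `|e j v|.
  apply: (@le_trans _ _ (\prod_(j in R) 2^-1)).
    rewrite prodr_const exprVn lef_pV2 ?posrE ?exprn_gt0 ?ltr0n //.
    by rewrite ler_weXn2l ?ler1n // card_real_emb leq_subr.
  rewrite [leRHS](eq_bigl (fun j => j \in R)); last first.
    by move=> j; rewrite !inE negb_or.
  by apply: ler_prod => j /vR/andP[-> _]; rewrite invr_ge0 ler0n.
apply: (@le_trans _ _ (2 ^+ n)); last first.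
  by rewrite expr2 ler_peMr ?exprn_ge0 ?exprn_ege1 ?ler0n ?ler1n.
rewrite -[leRHS]mul1r -ler_pdivrMr ?exprn_gt0 ?ltr0n // -[leRHS]prod1.
by rewrite ler_wpM2l ?exprn_ge0 ?normr_ge0.
Qed.

Lemma small_real_unit i : i \in R -> exists u : F,
  is_unit_OF u /\ forall j, j != i -> `|e j u| < 1.
Proof.
move=> /real_emb_in iR.
have [u [u0 Ou Ou' lt1]] := small_unit e_onto e_inj B_int B_span B_free iR.
by exists u; split.
Qed.

Lemma a_notin_R : a \notin R.
Proof. by rewrite !inE eqxx. Qed.

(** A relation between dilations is then a relation between units. The squares of the n-2 units
    attached to the real places are all small at [a], hence independent; more than n-2 units are
    dependent. *)
Lemma rank_injective :
  (forall u, totpos_unit u -> `|sigma u| ^+ 2 = 1 -> u = 1) ->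
  rank_OT sigma (n - 2).
Proof.
move=> ker1.
have dil_prod (I : finType) (u : I -> F) (z : I -> int) :
    \prod_k (`|sigma (u k)| ^+ 2) ^ z k = `|sigma (\prod_k u k ^ z k)| ^+ 2.
  rewrite normCK !rmorph_prod -big_split; apply: eq_bigr => k _ /=.
  by rewrite normCK expfzMl !fmorphXz.
have [u uP] :=
  fin_all_exists (fun k : {i | i \in R} => small_real_unit (valP k)).
have <- : #|{: {i | i \in R}}| = (n - 2)%N by rewrite card_sig card_real_emb.
pose w k := u k ^+ 2.
have Tw k : totpos_unit (w k) by apply: totpos_unit_sqr; case: (uP k).
apply: (has_rank_family (x := fun k => `|sigma (w k)| ^+ 2))
  => [k|z|m y Sy ltm].
- by exists (w k).
- rewrite dil_prod => /(ker1 _ (totpos_unit_prod _ Tw)).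
  have wU k := totpos_unit_is_unit (Tw k).
  apply: (multiplicatively_independent (e := e) (c := insub) (j0 := a)).
  + by move=> k; case: (wU k).
  + by move=> k; case: (wU k) => *; apply: (norm_emb_norm_unit e_inj B_span).
  + move=> k j neq_k; rewrite rmorphXn normrX exprn_ilt1 //; case: (uP k) => _.
    by apply; apply: contraNneq neq_k => ->; rewrite valK.
  by rewrite insubN // a_notin_R.
have [v vP] := fin_all_exists Sy.
have vU k : is_unit_OF (v k) by apply: totpos_unit_is_unit; case: (vP k).
have [||z [z0 prod1]] :=
  multiplicatively_dependent e_inj B_int B_span (w := v) (J := R) vU.
- by move=> z; apply: unit_bounded; apply: is_unit_OF_prod.
- by rewrite card_ord card_real_emb; move: ltm; rewrite card_sig card_real_emb.
exists z; split=> //.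
under eq_bigr => k _ do rewrite (proj2 (vP k)).
by rewrite dil_prod prod1 rmorph1 normr1 expr1n.
Qed.

Section Involution.

Variable iota : {rmorphism F -> F}.
Hypothesis iotaK : involutive iota.
Hypothesis sigma_iota : forall x, sigma (iota x) = (sigma x)^*.

(** A norm [v * iota v] takes the same value at the places [i] and [p i], so one place from each
    pair of real places controls it. *)
Lemma rank_involution : rank_OT sigma ((n - 2) %/ 2).
Proof.
have /fin_all_exists[p Dp] : forall i, exists j, forall x, e i (iota x) = e j x.
  by move=> i; have [j Dj] := e_onto (e i \o iota); exists j.
have pK : involutive p.
  by move=> i; apply: e_inj; rewrite /= -!Dp iotaK.
have pa : p a = b by apply: e_inj; rewrite -Dp -a_sigma sigma_iota b_sigma.
have pb : p b = a by rewrite -pa pK.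
(* A fixed place would make [iota] fix [theta], and then [a] and [p a = b] would agree on
   [theta]. *)
have p_neq i : p i != i.
  apply/eqP=> pi; have : iota theta = theta.
    by apply: (fmorph_inj (e i)); rewrite Dp pi.
  move/(congr1 (e a)); rewrite Dp pa => /e_inj ba.
  by have := complex_emb_neq; rewrite ba eqxx.
have pR i : (p i \in R) = (i \in R).
  have pib : (p i == b) = (i == a) by rewrite -pa (inj_eq (inv_inj pK)).
  have pia : (p i == a) = (i == b) by rewrite -pb (inj_eq (inv_inj pK)).
  by rewrite !inE pia pib orbC.
(* From each pair of real places take the one of smaller index. *)
pose P : {set 'I_n} := [set i in R | (i < p i)%N].
have PE i : (i \in P) = (i \in R) && (i < p i)%N by rewrite in_set.
have P_sub i : i \in P -> i \in R by rewrite PE => /andP[].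
have pP i : i \in R -> (p i \in P) = (i \notin P).
  move=> iR; rewrite !PE pR pK iR /= -leqNgt [RHS]leq_eqVlt.
  by have := p_neq i; rewrite -val_eqE => /negPf->.
have cardP : #|P| = ((n - 2) %/ 2)%N.
  have -> : #|P| = (#|P| * 2 %/ 2)%N by rewrite mulnK.
  congr (_ %/ _)%N; rewrite -card_real_emb -(cardsID P R) muln2 -addnn.
  congr (_ + _)%N; first by rewrite (setIidPr _) //; apply/subsetP.
  rewrite -(card_imset _ (inv_inj pK)); apply: eq_card => i.
  rewrite -[i in LHS]pK mem_imset; last exact: inv_inj.
  rewrite in_setD; have [iR|iR] := boolP (i \in R); last first.
    by rewrite andbF PE pR (negPf iR).
  by rewrite andbT (pP i iR).
have iota_dil u : `|sigma u| ^+ 2 = sigma (u * iota u).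
  by rewrite normCK rmorphM sigma_iota.
have [u uP] := fin_all_exists
  (fun k : {i | i \in P} => small_real_unit (P_sub _ (valP k))).
have <- : #|{: {i | i \in P}}| = ((n - 2) %/ 2)%N by rewrite card_sig cardP.
have iotaU v : is_unit_OF v -> is_unit_OF (iota v).
  move=> [v0 Ov Ov']; split; first by rewrite fmorph_eq0.
    by move=> s; apply: (Ov (s \o iota)).
  by move=> s; rewrite -fmorphV; apply: (Ov' (s \o iota)).
have sigma_prod (I : finType) (w : I -> F) (z : I -> int) :
    \prod_k sigma (w k) ^ z k = sigma (\prod_k w k ^ z k).
  by rewrite rmorph_prod; apply: eq_bigr => k _; rewrite fmorphXz.
pose w k := u k ^+ 2 * iota (u k ^+ 2).
have Tu k : totpos_unit (u k ^+ 2) by apply: totpos_unit_sqr; case: (uP k).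
have wU k : is_unit_OF (w k).
  by apply: is_unit_OFM; [|apply: iotaU]; apply: totpos_unit_is_unit.
apply: (has_rank_family (x := fun k => sigma (w k))) => [k|z|m y Sy ltm].
- by exists (u k ^+ 2); rewrite iota_dil.
- rewrite sigma_prod => /eqP; rewrite fmorph_eq1 => /eqP.
  (* Both members of a pair are marked by its representative, since [w k] may be large at [k] and at
     [p k]. *)
  pose c (j : 'I_n) : option {i | i \in P} :=
    if j \in P then insub j else insub (p j).
  apply: (multiplicatively_independent (e := e) (c := c) (j0 := a)).
  + by move=> k; case: (wU k).
  + by move=> k; case: (wU k) => *; apply: (norm_emb_norm_unit e_inj B_span).
  + move=> k j neq_k; rewrite /w rmorphM Dp !rmorphXn -exprMn normrX.
    have [_ lt1] := uP k.
    rewrite exprn_ilt1 // normrM mulr_ilt1 // lt1 //.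
      by apply: contraNneq neq_k => ->; rewrite /c (valP k) valK.
    apply: contraNneq neq_k => Dk; have jP : j \notin P.
      have := valP k; rewrite -Dk => pjP.
      by rewrite -pP // -pR; apply: P_sub.
    by rewrite /c (negPf jP) Dk valK.
  rewrite /c PE (negPf a_notin_R) pa; apply: insubN; rewrite PE.
  by rewrite -[b \in R]pR pb (negPf a_notin_R).
have [v vP] := fin_all_exists Sy.
have vU k : is_unit_OF (v k) by apply: totpos_unit_is_unit; case: (vP k).
have wvU k : is_unit_OF (v k * iota (v k)).
  by apply: is_unit_OFM => //; apply: iotaU.
have [||z [z0 prod1]] := multiplicatively_dependent e_inj B_int B_span
  (w := fun k => v k * iota (v k)) (J := P) wvU.
- move=> z x xP; apply: unit_bounded; first exact: is_unit_OF_prod.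
  move=> j jR; have [jP|jP] := boolP (j \in P); first exact: xP.
  have -> : e j x = e (p j) x.
    rewrite -Dp; congr (e j _); rewrite /x rmorph_prod; apply: eq_bigr => k _.
    by rewrite fmorphXz rmorphM iotaK mulrC.
  by apply: xP; rewrite pP.
- by rewrite card_ord; move: ltm; rewrite card_sig.
exists z; split=> //.
under eq_bigr => k _ do rewrite (proj2 (vP k)) iota_dil.
by rewrite sigma_prod prod1 rmorph1.
Qed.

End Involution.

End OneComplexPlace.

(** * Quadratic subfields and the kernel of the dilation map *)

Lemma embeddings (F : fieldExtType rat) (sigma : {rmorphism F -> algC}) :
  exists (e : 'I_(\dim {:F}) -> {rmorphism F -> algC}) (theta : F),
    (forall tau : {rmorphism F -> algC}, exists i, tau =1 e i) /\
    injective (fun i => e i theta).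
Proof.
have := extensions (sigma \o vsval : {rmorphism subvs_of 1%AS -> algC}).
rewrite dimv1 divn1 => -[theta [e [_ e_inj e_onto]]]; exists e, theta.
split=> // tau; apply: e_onto => y.
have /vlineP[c Dc] : vsval y \in 1%VS by apply: subvsP.
by rewrite /= Dc !rmorphZ_num !rmorph1.
Qed.

(** The involution sends a generator [x] to the other root [r] of its quadratic minimal polynomial,
    given by the sum of the roots. If it fixed [x], then [x] would be half of that sum and lie in
    K. *)
Lemma quadratic_involution (F : fieldExtType rat) (K : {subfield F}) :
  (\dim {:F} = 2 * \dim K)%N ->
  exists (iota : {rmorphism F -> F}) (x : F), involutive iota /\ iota x != x.
Proof.
move=> dimF; have [x genF] := primitive_element K.
have K0 : (0 < \dim K)%N by apply: adim_gt0.
have deg2 : adjoin_degree K x = 2.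
  by apply/eqP; rewrite -(eqn_pmul2r K0) -dim_Fadjoin genF dimF.
have /polyOver_subvs[q defq] := minPolyOver K x.
have sz_p : size (minPoly K x) = 3 by rewrite size_minPoly deg2.
have p2 : (minPoly K x)`_2 = 1.
  by have := monicP (monic_minPoly K x); rewrite /lead_coef sz_p.
have pE y :
    (minPoly K x).[y] = (minPoly K x)`_0 + (minPoly K x)`_1 * y + y ^+ 2.
  by rewrite horner_coef sz_p !big_ord_recr big_ord0 /= p2; ring.
pose r := - (minPoly K x)`_1 - x.
have px0 := minPolyxx K x; rewrite pE in px0.
have pr0 : root (map_poly vsval q) r.
  by rewrite -defq /root pE -[X in _ == X]px0; apply/eqP; rewrite /r; ring.
have [iota [iotaK iotax]] :=
  extend_root (rho := vsval : {rmorphism subvs_of K -> F}) genF defq pr0.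
have p1K : (minPoly K x)`_1 = vsval q`_1 by rewrite defq coef_map.
have iotar : iota r = x.
  by rewrite /r rmorphB rmorphN iotax p1K iotaK /= -p1K /r; ring.
exists iota, x; split.
  move=> y; have : y \in <<K; x>>%VS by rewrite genF memvf.
  case/Fadjoin_polyP=> _ /polyOver_subvs[p ->] ->.
  rewrite -!horner_map /= iotax iotar -!map_poly_comp; congr _.[_].
  by apply: eq_map_poly => c /=; rewrite !iotaK.
apply/eqP=> fix_x; have xK : x \in K.
  have Dp1 : (minPoly K x)`_1 = (- 2%:R : rat) *: x.
    by rewrite scaleNr scaler_nat mulr2n -[X in - (X + _)]fix_x iotax /r; ring.
  have -> : x = (- 2%:R)^-1 *: (minPoly K x)`_1 by rewrite Dp1 scalerK.
  by rewrite memvZ // (polyOverP (minPolyOver K x)).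
move: dimF; rewrite -genF (Fadjoin_idP xK) => /eqP.
by rewrite -{1}[\dim K]mul1n eqn_pmul2r.
Qed.

Lemma kernel_quadratic (F : fieldExtType rat) (sigma : {rmorphism F -> algC})
    (u : F) :
  (forall tau : {rmorphism F -> algC}, ~ real_emb tau ->
     (forall x, tau x = sigma x) \/ (forall x, tau x = (sigma x)^*)) ->
  (exists tau : {rmorphism F -> algC}, real_emb tau) ->
  totpos_unit u -> `|sigma u| ^+ 2 = 1 -> u != 1 -> quad_ext_of_totally_real F.
Proof.
move=> only_sigma [tau0 tau0R] [u0 _ _ u_pos] norm1 u1.
have uu : sigma u * (sigma u)^* = 1 by rewrite -normCK.
(* A real number of absolute value 1 is 1 or -1, and -1 is excluded by positivity at [tau0]. *)
have su_nonreal : sigma u \isn't Num.real.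
  apply/negP=> /CrealP su; move/eqP: uu; rewrite su -expr2 sqrf_eq1.
  case/orP; first by rewrite fmorph_eq1 (negPf u1).
  rewrite -(rmorphN1 sigma) => /eqP/fmorph_inj Du.
  by have := u_pos _ tau0R; rewrite Du rmorphN1 oppr_gt0 ltr10.
have genF : <<1; u>>%VS = fullv.
  have [x [e [eK e_inj _]]] :=
    extensions (sigma \o vsval : {rmorphism subvs_of <<1; u>>%AS -> algC}).
  (* An extension of [sigma] from Q(u) is not real at [u], and it is not the conjugate of [sigma],
     so it is [sigma]. *)
  have e_sigma i : e i x = sigma x.
    have eiu : e i u = sigma u.
      by have /= := eK i (Subvs (memv_adjoin 1 u)).
    have : ~ real_emb (e i) by move/(_ u); rewrite eiu; apply/negP.
    case/only_sigma => // /(_ u); rewrite eiu => /esym/CrealP.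
    by rewrite (negPf su_nonreal).
  have le1 : (\dim {:F} %/ \dim <<1; u>> <= 1)%N.
    rewrite leqNgt; apply/negP=> lt1; have lt0 := ltnW lt1.
    have := @e_inj (Ordinal lt0) (Ordinal lt1).
    by rewrite /= !e_sigma => /(_ erefl)/(congr1 val).
  apply/eqP; rewrite eqEdim subvf /=.
  rewrite -(divnK (field_dimS (subvf <<1; u>>%AS))).
  by rewrite -[leqRHS]mul1n leq_mul2r le1 orbT.
pose w := u + u^-1; pose K : {subfield F} := <<1; w>>%AS.
have sigma_w : sigma w \is Num.real.
  have uinv : (sigma u)^* = (sigma u)^-1.
    by apply: (mulfI (_ : sigma u != 0)); rewrite ?uu ?divff ?fmorph_eq0.
  apply/CrealP; rewrite rmorphD fmorphV rmorphD fmorphV /= uinv invrK.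
  exact: addrC.
have sigma_K y : y \in K -> sigma y \is Num.real.
  case/Fadjoin1_polyP=> p ->; rewrite -horner_map rpred_horner //.
  apply/polyOverP=> i; rewrite !coef_map /= rmorphZ_num rmorph1 mulr1.
  exact: rpred_rat.
have uK : u \notin K by apply: contra su_nonreal; apply: sigma_K.
have genK : <<K; u>>%VS = fullv.
  apply/eqP; rewrite eqEsubv subvf -genF; apply/FadjoinP; split.
    by rewrite sub1v.
  exact: memv_adjoin.
have deg2 : adjoin_degree K u = 2.
  have wK : w \in K by apply: memv_adjoin.
  (* The polynomial X^2 - wX + 1, with roots [u] and 1/u. *)
  pose p : {poly F} := 'X^2 + (1 - w%:P * 'X).
  have pK : p \is a polyOver K.
    rewrite rpredD ?rpredX ?polyOverX // rpredB ?rpred1 //.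
    by rewrite rpredM ?polyOverX ?polyOverC.
  have pu : root p u.
    rewrite /root !hornerE /w; apply/eqP.
    by rewrite -[LHS]/(u ^+ 2 + 1 - (u + u^-1) * u) mulrDl mulVf //; ring.
  have sz_p : size p = 3.
    rewrite size_polyDl ?size_polyXn // (leq_ltn_trans (size_polyD _ _)) //.
    rewrite size_polyN gtn_max size_poly1 /=.
    rewrite (leq_ltn_trans (size_polyMleq _ _)) //.
    by rewrite size_polyX addn2 /= !ltnS size_polyC_leq1.
  have p0 : p != 0 by rewrite -size_poly_eq0 sz_p.
  have deg_le := dvdp_leq p0 (minPoly_dvdp pK pu).
  rewrite size_minPoly sz_p ltnS in deg_le.
  apply/eqP; rewrite eqn_leq deg_le /= ltnNge; apply/negP=> deg1.
  case/negP: uK.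
  have dim_le : (\dim <<K; u>> <= \dim K)%N.
    by rewrite dim_Fadjoin -[leqRHS]mul1n leq_mul2r deg1 orbT.
  have /eqP -> : K == <<K; u>>%VS :> {vspace F} by rewrite eqEdim subv_adjoin.
  exact: memv_adjoin.
exists K; split; first by rewrite -genK dim_Fadjoin deg2.
(* An extension of [rho] to F is real, or is [sigma] or its conjugate, which are real on K. *)
move=> rho y; have [x [e [eK _ _]]] := extensions rho.
have index2 : (\dim {:F} %/ \dim K = 2)%N.
  by rewrite -genK dim_Fadjoin deg2 mulnK ?adim_gt0.
have lt0 : (0 < \dim {:F} %/ \dim K)%N by rewrite index2.
rewrite -(eK (Ordinal lt0)); apply/idPn => yR.
have : ~ real_emb (e (Ordinal lt0)) by move/(_ (vsval y)); apply/negP.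
by case/only_sigma=> Dy; rewrite Dy ?conj_Creal ?sigma_K ?subvsP in yR.
Qed.

Theorem theorem5p3 (F : fieldExtType rat) (sigma : {rmorphism F -> algC}) :
  (* n = [F:Q] with s = n - 2 > 0 *)
  (2 < \dim {:F})%N ->
  (* sigma = sigma_{s+1} is non-real *)
  ~ real_emb sigma ->
  (* exactly two non-real embeddings: sigma and its complex conjugate *)
  (forall tau : {rmorphism F -> algC}, ~ real_emb tau ->
     (forall x, tau x = sigma x) \/ (forall x, tau x = (sigma x)^*)) ->
  let n := \dim {:F} in
  (odd n ->
     (forall u v : F, totpos_unit u -> totpos_unit v ->
        `|sigma u| ^+ 2 = `|sigma v| ^+ 2 -> u = v)
     /\ rank_OT sigma (n - 2)) /\
  (~~ odd n ->
     (rank_OT sigma (n - 2) \/ rank_OT sigma ((n - 2) %/ 2)) /\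
     (rank_OT sigma ((n - 2) %/ 2) <-> quad_ext_of_totally_real F)).
Proof.
move=> n_gt2 sigma_nonreal only_sigma n.
have [e [theta [e_onto e_inj]]] := embeddings sigma.
have [B [B_int B_span B_free]] := integral_basis F.
have [a Da] := e_onto sigma.
have [b Db] : exists b, forall x, (sigma x)^* = e b x.
  by have [b Db] := e_onto (Num.conj \o sigma); exists b.
have rank_inj := rank_injective sigma_nonreal only_sigma e_onto e_inj
  B_int B_span B_free Da Db.
have rank_quad : quad_ext_of_totally_real F -> rank_OT sigma ((n - 2) %/ 2).
  case=> K [dimF _]; have [iota [x [iotaK iotax]]] := quadratic_involution dimF.
  apply: (rank_involution sigma_nonreal only_sigma e_onto e_inj
    B_int B_span B_free Da Db iotaK).
  (* The composite is [sigma] or its conjugate; the first would make [iota] fix [x]. *)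
  have : ~ real_emb (sigma \o iota).
    by move=> sR; apply: sigma_nonreal => y; rewrite -[y]iotaK; apply: sR.
  case/only_sigma=> // /(_ x) /= eq_x; case/eqP: iotax.
  exact: (fmorph_inj sigma).
have [tau tauR] : exists tau : {rmorphism F -> algC}, real_emb tau.
  have : (0 < #|~: [set a; b]|)%N.
    by rewrite (card_real_emb sigma_nonreal Da Db) subn_gt0.
  case/card_gt0P=> i iR; exists (e i).
  exact: (real_emb_in only_sigma e_inj Da Db).
have kernel u : totpos_unit u -> `|sigma u| ^+ 2 = 1 ->
    ~ quad_ext_of_totally_real F -> u = 1.
  move=> Tu norm1 not_quad; apply/eqP/idPn => u1; apply: not_quad.
  by apply: (kernel_quadratic only_sigma _ Tu norm1 u1); exists tau.
split=> [odd_n|_].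
  have not_quad : ~ quad_ext_of_totally_real F.
    by case=> K [dimF _]; rewrite /n dimF mul2n odd_double in odd_n.
  split=> [u v Tu Tv eq_uv|]; last by apply: rank_inj => u Tu /kernel; apply.
  have [u0 _ _ _] := Tu; have [v0 _ _ _] := Tv.
  have Tuv : totpos_unit (u / v).
    have := @totpos_unit_prod F 'I_2 (fun i => [:: u; v]`_i)
      (fun i => [:: 1; -1]`_i).
    rewrite !big_ord_recl big_ord0 mulr1 /=; apply.
    by case=> [[|[|i]] lti].
  suff /divr1_eq : u / v = 1 by [].
  apply: kernel => //; rewrite rmorphM fmorphV normrM normfV exprMn eq_uv.
  by rewrite -exprMn divff ?expr1n ?normr_eq0 ?fmorph_eq0.
have [quad|not_quad] := classic (quad_ext_of_totally_real F).
  by split; [right | split] => //; apply: rank_quad.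
have rank_n : rank_OT sigma (n - 2) by apply: rank_inj => u Tu /kernel; apply.
split; first by left.
(* As n - 2 is positive, it differs from its half. *)
split=> // /(has_rank_inj rank_n) eq_rank; exfalso.
have := n_gt2; rewrite -/n -subn_gt0 => n2.
by have := ltn_Pdiv (isT : 1 < 2)%N n2; rewrite -eq_rank ltnn.
Qed.
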